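(* For integers $m,n\ge 1$ and $d\ge 0$, let $h(m,n,d)$ be the number of $m\times n$ Cauchon diagrams whose toric permutation has exactly $d$ odd cycles, where an odd cycle is a cycle of even length in the disjoint cycle decomposition. Then for all $m,n\ge1$ and $d\ge0$, $h(m,n,d)$ equals the coefficient of $t^d\frac{x^m}{m!}\frac{y^n}{n!}$ in the power series expansion of $$C(x,y,t)=(e^{-y}+e^{-x}-1)^{\frac{-1-t}{2}}(e^x+e^y-1)^{\frac{1-t}{2}}.$$
   Context: An $m\times n$ diagram is an $m\times n$ grid of squares, each coloured black or white. Rows are numbered top to bottom and columns left to right. It is a Cauchon diagram if for every black square, either all squares strictly above it in its column are black or all squares strictly to its left in its row are black. Pipe dreams: on each white square place two arcs, one joining its bottom and left edge midpoints and one joining its top and right edge midpoints. On each black square place a cross, i.e. a vertical segment joining its bottom and top midpoints and a horizontal segment joining its left and right midpoints. Label the boundary as follows: the row that is $r$-th from the bottom gets label $r$ at its left end and $n+r$ at its right end; column $j$ gets label $m+j$ at its top and $j$ at its bottom. The restricted permutation $\sigma\in S_{m+n}$ of $D$ sends a label $i$ on the bottom or right side to the label on the left or top side where the pipe entering at $i$ exits (going straight through crosses). The permutation $\omega$ is defined by $\omega(i)=m+i$ for $1\le i\le n$ and $\omega(i)=i-n$ for $n<i\le m+n$. The toric permutation of $D$ is $\tau=\sigma\omega^{-1}$. *)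

(* Defs.v *)
From mathcomp Require Import all_boot all_order all_algebra all_fingroup.
Set Implicit Arguments. Unset Strict Implicit. Unset Printing Implicit Defensive.
Import GRing.Theory.
Local Open Scope ring_scope.

(* An m x n diagram: D (i, j) = true iff square (i,j) is black.
   Rows i : 'I_m are numbered 0..m-1 top to bottom, columns j : 'I_n
   0..n-1 left to right. *)
Definition diagram (m n : nat) := {ffun 'I_m * 'I_n -> bool}.

Definition cauchon (m n : nat) (D : diagram m n) : bool :=
  [forall ij : 'I_m * 'I_n, D ij ==>
     ([forall i' : 'I_m, (i' < ij.1)%N ==> D (i', ij.2)]
      || [forall j' : 'I_n, (j' < ij.2)%N ==> D (ij.1, j')])].

Definition blk (m n : nat) (D : diagram m n) (i j : nat) : bool :=
  match (insub i : option 'I_m), (insub j : option 'I_n) with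
  | Some i', Some j' => D (i', j')
  | _, _ => false
  end.

(* Following a pipe through the pipe dream.  [up = true]: the pipe enters
   square (i,j) through its bottom edge; [up = false]: through its right edge.
   White square: bottom<->left arc and top<->right arc; black square: cross.
   Result: the label where the pipe exits on the left or top boundary.
   Row i (0-based from the top) is the (m-i)-th row from the bottom, so its
   left label is m - i; column j (0-based) has top label m + (j+1).
   Each step moves up or left, so m + n steps of fuel suffice. *)
Fixpoint trace (m n : nat) (D : diagram m n) (fuel : nat) (up : bool)
  (i j : nat) : nat :=
  match fuel with
  | 0 => 0
  | fuel'.+1 =>
    if up then
      if blk D i j then
        (if i is i'.+1 then trace D fuel' true i' j else (m + j.+1)%N)
      else
        (if j is j'.+1 then trace D fuel' false i j' else (m - i)%N)
    else
      if blk D i j then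
        (if j is j'.+1 then trace D fuel' false i j' else (m - i)%N)
      else
        (if i is i'.+1 then trace D fuel' true i' j else (m + j.+1)%N)
  end.

(* Restricted permutation sigma on labels 1..m+n: label k <= n is the bottom
   of column k (0-based column k-1, entering square (m-1, k-1) from below);
   label k = n + r (1 <= r <= m) is the right end of the r-th row from the
   bottom (0-based row m - r, entering square (m-r, n-1) from the right). *)
Definition sigma_nat (m n : nat) (D : diagram m n) (k : nat) : nat :=
  if (k <= n)%N then trace D (m + n) true m.-1 k.-1
  else trace D (m + n) false (m - (k - n)) n.-1.

Definition omega_nat (m n : nat) (i : nat) : nat :=
  if (i <= n)%N then (m + i)%N else (i - n)%N.
Definition omega_inv_nat (m n : nat) (k : nat) : nat :=
  if (m < k)%N then (k - m)%N else (k + n)%N.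

Definition toric_nat (m n : nat) (D : diagram m n) (k : nat) : nat :=
  sigma_nat D (omega_inv_nat m n k).

Definition toric_fun (m n : nat) (D : diagram m n) (x : 'I_(m + n)) : 'I_(m + n) :=
  insubd x (toric_nat D x.+1).-1.

(* the toric permutation as an element of the symmetric group (it is always
   a bijection; [None] never occurs) *)
Definition toric_perm (m n : nat) (D : diagram m n) : option {perm 'I_(m + n)} :=
  if injectiveP (toric_fun D) is ReflectT H then Some (perm H) else None.

(* number of "odd cycles" = cycles of even length *)
Definition num_odd_cycles (N : nat) (s : {perm 'I_N}) : nat :=
  #|[set C in porbits s | ~~ odd #|C|]|.

Definition h (m n d : nat) : nat :=
  #|[set D : diagram m n | cauchon D &&
       (if toric_perm D is Some s then num_odd_cycles s == d else false)]|.

Definition R := {poly rat}.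
(* f i j = coefficient of x^i y^j *)
Definition fps := nat -> nat -> R.

Definition fone : fps := fun i j => if (i == 0%N) && (j == 0%N) then 1 else 0.
Definition fadd (f g : fps) : fps := fun i j => f i j + g i j.
Definition fsub (f g : fps) : fps := fun i j => f i j - g i j.
Definition fmul (f g : fps) : fps := fun i j =>
  \sum_(a < i.+1) \sum_(b < j.+1) f a b * g (i - a)%N (j - b)%N.
Fixpoint fpow (f : fps) (k : nat) : fps :=
  if k is k'.+1 then fmul f (fpow f k') else fone.

Definition fexpx (c : rat) : fps := fun i j =>
  if j == 0%N then ((c ^+ i) / (i`!)%:R)%:P else 0.
Definition fexpy (c : rat) : fps := fun i j =>
  if i == 0%N then ((c ^+ j) / (j`!)%:R)%:P else 0.

Definition gbinom (s : R) (k : nat) : R :=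
  ((k`!)%:R^-1 : rat) *: \prod_(l < k) (s - l%:R).

(* G^s for G with constant term 1:  sum_k binom(s,k) (G-1)^k
   (the coefficient of x^i y^j only involves k <= i + j) *)
Definition fpowr (G : fps) (s : R) : fps := fun i j =>
  \sum_(k < (i + j).+1) gbinom s k * fpow (fsub G fone) k i j.

Definition Cser : fps :=
  fmul (fpowr (fsub (fadd (fexpy (-1)) (fexpx (-1))) fone) ((2^-1 : rat) *: (-1 - 'X)))
       (fpowr (fsub (fadd (fexpx 1) (fexpy 1)) fone) ((2^-1 : rat) *: (1 - 'X))).

(* Main.v *)
Require Import Defs.
From mathcomp Require Import all_boot all_order all_algebra all_fingroup.
From mathcomp Require Import ring lra zify.
Set Implicit Arguments. Unset Strict Implicit. Unset Printing Implicit Defensive.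
Import GRing.Theory Num.Theory.
Local Open Scope ring_scope.

(* The toric permutation of a diagram is the product, over its white squares, of
   the transpositions exchanging the labels of their row and column.  Peeling
   off the bottom row shows that Cauchon diagrams correspond bijectively to the
   permutations s with s k >= k on the m row labels and s k <= k on the n column
   labels.

   Let F w be the sum over such s of the product over the cycles c of w |c|,
   extended to subsets of the labels.  Distributing a product of sums over the
   cycles gives F (w1 + w2) S = sum_(A <= S) F w1 A * F w2 (S - A), so sums of
   weights become products of exponential generating functions.  For the weight
   - (-1)^l, F is a signed sum, whose generating function e^x + e^y - 1 follows
   from a sign-reversing involution; for the weight -1 it is the same up to
   (-1)^|S|, which gives e^-x + e^-y - 1.  At t = -(2k+1), the weight "1 on odd
   lengths, t on even ones" is k times the second weight plus k+1 times the
   first, so both sides of the theorem are (e^-x + e^-y - 1)^k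
   (e^x + e^y - 1)^(k+1).  Two polynomials in t agreeing at all these points
   are equal. *)

(** * Powers of bivariate series *)

Lemma fmul_onel (f : fps) i j : fmul fone f i j = f i j.
Proof.
rewrite /fmul big_ord_recl big_ord_recl /fone /= mul1r !subn0.
rewrite big1 ?addr0 => [|b _]; last by rewrite mul0r.
by rewrite big1 ?addr0 // => a _; rewrite big1 // => b _; rewrite mul0r.
Qed.

(** Induction on [k] through G^(k+1) = G^k + (G-1) G^k and Pascal's rule. The bound [K] is free
    because the two summands are expanded up to different bounds. *)
Lemma fpow_binomial (G : fps) k K i j : (k <= K)%N ->
  fpow G k i j = \sum_(p < K.+1) 'C(k, p)%:R * fpow (fsub G fone) p i j.
Proof.
elim: k K i j => [|k IH] [|K] i j // lekK.
- by rewrite big_ord_recl big_ord0 /= mul1r addr0.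
- rewrite big_ord_recl /= mul1r big1 ?addr0 // => p _.
  by rewrite bin0n mul0r.
have step : fpow G k.+1 i j = fpow G k i j + fmul (fsub G fone) (fpow G k) i j.
  rewrite -[X in X + _]fmul_onel /= /fmul -big_split; apply: eq_bigr => a _.
  rewrite -big_split; apply: eq_bigr => b _ /=.
  by rewrite -mulrDl addrC subrK.
have shift : fmul (fsub G fone) (fpow G k) i j =
    \sum_(p < K.+1) 'C(k, p)%:R * fpow (fsub G fone) p.+1 i j.
  under [RHS]eq_bigr => p _ do rewrite mulr_sumr.
  rewrite exchange_big; apply: eq_bigr => a _ /=.
  under [RHS]eq_bigr => p _ do rewrite mulr_sumr.
  rewrite exchange_big; apply: eq_bigr => b _ /=.
  rewrite (IH K) // mulr_sumr; apply: eq_bigr => p _.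
  by rewrite mulrCA.
rewrite step shift (IH K.+1); last exact: leqW.
rewrite big_ord_recl [RHS]big_ord_recl -addrA !bin0; congr (_ + _).
rewrite -big_split; apply: eq_bigr => p _ /=.
by rewrite /bump /= add1n binS natrD mulrDl.
Qed.

Lemma fpow_val (u : fps) p i j : u 0 0 = 0 -> (i + j < p)%N -> fpow u p i j = 0.
Proof.
move=> u0; elim: p i j => [|p IH] i j // ltij /=.
rewrite /fmul big1 // => a _; rewrite big1 // => b _.
have [|ab0] := boolP ((a + b)%N == 0%N).
  by rewrite addn_eq0 => /andP[/eqP-> /eqP->]; rewrite u0 mul0r.
by rewrite IH ?mulr0 //; move: ltij ab0 (ltn_ord a) (ltn_ord b); lia.
Qed.

Lemma horner_gbinom (s : R) (t : rat) k p : s.[t] = k%:R ->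
  (gbinom s p).[t] = 'C(k, p)%:R.
Proof.
move=> st; rewrite /gbinom hornerZ horner_prod.
under eq_bigr => l _ do rewrite hornerD hornerN st -polyC_natr hornerC.
have -> : \prod_(l < p) (k%:R - l%:R) = (k ^_ p)%:R :> rat.
  elim: p => [|p IH]; first by rewrite big_ord0.
  rewrite big_ord_recr /= IH ffactnSr natrM.
  by case: (leqP p k) => [/natrB->|/ffact_small->]; rewrite ?mul0r.
by rewrite -bin_ffact natrM mulrC mulfK // pnatr_eq0 -lt0n fact_gt0.
Qed.

(** Both sides truncate one sum of binomials times powers of G-1, the left after i+j and the right
    after k. Padding either to k+i+j adds only zeros: the binomial vanishes for p > k, and (G-1)^p
    has no term of degree i+j for p > i+j. *)
Lemma horner_fpowr (G : fps) (s : R) (t : rat) k i j :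
  G 0 0 = 1 -> s.[t] = k%:R -> (fpowr G s i j).[t] = (fpow G k i j).[t].
Proof.
move=> G1 st; have u0 : fsub G fone 0 0 = 0 by rewrite /fsub /fone G1 subrr.
rewrite (fpow_binomial G i j (leq_addr (i + j) k)) /fpowr !horner_sum.
pose c p := 'C(k, p)%:R * (fpow (fsub G fone) p i j).[t].
transitivity (\sum_(0 <= p < (i + j).+1) c p).
  rewrite big_mkord; apply: eq_bigr => p _.
  by rewrite hornerM (horner_gbinom _ st).
transitivity (\sum_(0 <= p < (k + (i + j)).+1) c p); last first.
  rewrite big_mkord; apply: eq_bigr => p _.
  by rewrite hornerM -polyC_natr hornerC.
rewrite [RHS](@big_cat_nat _ _ _ (i + j).+1) //=; last by rewrite ltnS leq_addl.
rewrite [X in _ = _ + X]big_nat [X in _ = _ + X]big1 ?addr0 // => p /andP[ltp _].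
by rewrite /c fpow_val // horner0 mulr0.
Qed.

Definition Gpos : fps := fsub (fadd (fexpx 1) (fexpy 1)) fone.
Definition Gneg : fps := fsub (fadd (fexpy (-1)) (fexpx (-1))) fone.

(** At t = -(2k+1) the exponents (-1-t)/2 and (1-t)/2 are k and k+1, so both real powers become
    ordinary ones. *)
Lemma horner_Cser (k i j : nat) (t := - (k.*2.+1)%:R : rat) :
  (Cser i j).[t] = (fmul (fpow Gneg k) (fpow Gpos k.+1) i j).[t].
Proof.
have G1 c c' : fsub (fadd (fexpx c) (fexpy c')) fone 0 0 = 1.
  by rewrite /fsub /fadd /fexpx /fexpy /fone /= !expr0 divr1 addrK.
have t2 : t = - (k%:R * 2 + 1) by rewrite /t -addn1 -muln2 natrD natrM.
rewrite /Cser /fmul !horner_sum; apply: eq_bigr => a _.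
rewrite !horner_sum; apply: eq_bigr => b _; rewrite !hornerM.
congr (_ * _); apply: horner_fpowr.
- by rewrite -(G1 (-1) (-1)) /Gneg /fsub /fadd; congr (_ - _); rewrite addrC.
- by rewrite !hornerE t2; field.
- exact: G1.
- by rewrite !hornerE t2 -addn1 natrD; field.
Qed.

(** * Sums over permutations weighted by cycle lengths *)

Lemma prod_add_subset (K : comNzRingType) (I : finType) (A : {set I}) (f g : I -> K) :
  \prod_(i in A) (f i + g i) =
  \sum_(J : {set I} | J \subset A) (\prod_(i in J) f i) * \prod_(i in A :\: J) g i.
Proof.
(* [bigA_distr] sums over all subsets of [I]: the value 0 of [f'] off [A] kills those not inside
   [A], and the value 1 of [g'] there leaves the other products unchanged. *)
pose f' i := if i \in A then f i else 0; pose g' i := if i \in A then g i else 1.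
rewrite big_mkcond /=.
transitivity (\prod_i (f' i + g' i)).
  by apply: eq_bigr => i _; rewrite /f' /g'; case: ifP => // _; rewrite add0r.
rewrite bigA_distr (bigID (fun J : {set I} => J \subset A)) /=.
rewrite [X in _ + X]big1 ?addr0 => [|J /subsetPn[i iJ iA]]; last first.
  by rewrite (bigD1 i) //= iJ /f' (negPf iA) mul0r.
apply: eq_bigr => J JA; rewrite (bigID (mem J)) /=; congr (_ * _).
  by apply: eq_bigr => i iJ; rewrite iJ /f' (subsetP JA).
rewrite big_mkcond [RHS]big_mkcond /=; apply: eq_bigr => i _.
by rewrite inE /g'; case: (i \in J); case: (i \in A).
Qed.

Section Cycles.
Variable T : finType.
Implicit Types (s t : {perm T}) (A S : {set T}).

(** Since [T] is finite, this says that [A] is a union of cycles of [s]. *)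
Definition stable s A := [forall x, (s x \in A) == (x \in A)].

Definition cycles_in s A := [set C in porbits s | C \subset A].

Lemma stableP s A : reflect (forall x, (s x \in A) = (x \in A)) (stable s A).
Proof. by apply: (iffP forallP) => H x; apply/eqP. Qed.

Lemma stable_iter s A i x : stable s A -> ((s ^+ i)%g x \in A) = (x \in A).
Proof.
move/stableP=> sA; elim: i => [|i IH]; first by rewrite expg0 perm1.
by rewrite expgSr permM sA.
Qed.

Lemma porbit_sub s A x : stable s A -> (porbit s x \subset A) = (x \in A).
Proof.
move=> sA; apply/subsetP/idP => [|xA y]; first by apply; exact: porbit_id.
by case/porbitP=> i ->; rewrite stable_iter.
Qed.

Lemma porbits_mem s C x : C \in porbits s -> x \in C -> C = porbit s x.
Proof. by case/imsetP=> y _ -> xy; apply/esym/eqP; rewrite eq_porbit_mem. Qed.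

Lemma porbits_neq0 s C : C \in porbits s -> exists x, x \in C.
Proof. by case/imsetP=> x _ ->; exists x; exact: porbit_id. Qed.

Lemma porbits_sub_trivIset s (P : {set {set T}}) : P \subset porbits s -> trivIset P.
Proof.
move/subsetP=> Ps; apply/trivIsetP => B C /Ps Bs /Ps Cs.
apply: contraR; case/pred0Pn=> x /andP[/= xB xC].
by rewrite (porbits_mem Bs xB) (porbits_mem Cs xC).
Qed.

Lemma cover_cycles_in s A : stable s A -> cover (cycles_in s A) = A.
Proof.
move=> sA; apply/setP => x; apply/bigcupP/idP => [[C]|xA].
  by rewrite inE => /andP[_ /subsetP CA] /CA.
exists (porbit s x); last exact: porbit_id.
by rewrite inE imset_f //= porbit_sub.
Qed.

Lemma card_cycles_in s A : stable s A -> (\sum_(C in cycles_in s A) #|C| = #|A|)%N.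
Proof.
move=> sA; rewrite -[in RHS](cover_cycles_in sA); apply/eqP.
by apply: (@porbits_sub_trivIset s); apply/subsetP => C /setIdP[].
Qed.

Lemma stable_cover s (J : {set {set T}}) : J \subset porbits s -> stable s (cover J).
Proof.
move/subsetP=> Js; apply/stableP => x.
have mem_eq C : C \in J -> (s x \in C) = (x \in C).
  move/Js/imsetP=> [y _ ->]; rewrite -!eq_porbit_mem.
  by have := porbit_perm s 1 x; rewrite expg1 => ->.
apply/bigcupP/bigcupP=> -[C CJ xC]; exists C => //; first by rewrite -mem_eq.
by rewrite mem_eq.
Qed.

Lemma cycles_in_cover s (J : {set {set T}}) :
  J \subset porbits s -> cycles_in s (cover J) = J.
Proof.
move=> Js; apply/setP => C; rewrite inE; apply/andP/idP => [[Cs CJ]|CJ].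
  have [x xC] := porbits_neq0 Cs.
  have /bigcupP[B BJ xB] := subsetP CJ _ xC.
  by rewrite (porbits_mem Cs xC) -(porbits_mem (subsetP Js _ BJ) xB).
by split; [exact: (subsetP Js) | exact: (bigcup_sup C)].
Qed.

Lemma cycles_inD s A S : A \subset S -> stable s A ->
  cycles_in s S :\: cycles_in s A = cycles_in s (S :\: A).
Proof.
move=> AS sA; apply/setP => C; rewrite in_setD !in_set subsetD.
have [Cs|Cs] := boolP (C \in porbits s); last by rewrite /= ?andbF.
rewrite /= andbC; congr (_ && _); have [x xC] := porbits_neq0 Cs.
have CE := porbits_mem Cs xC; rewrite {1}CE porbit_sub //.
apply/idP/idP => [xA|CA]; last by rewrite (disjointFr CA xC).
apply/pred0P => y /=; apply/negP => /andP[yC yA].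
by rewrite -(porbit_sub _ sA) -CE (porbits_mem Cs yC) porbit_sub ?yA in xA.
Qed.

Lemma cycles_in_sub s A S : A \subset S -> cycles_in s A \subset cycles_in s S.
Proof.
move=> AS; apply/subsetP => C; rewrite !inE => /andP[-> CA].
exact: subset_trans CA AS.
Qed.

Lemma eq_cycles_in s t A : stable s A -> {in A, s =1 t} ->
  cycles_in s A = cycles_in t A.
Proof.
move=> sA st.
have iterE i x : x \in A -> (s ^+ i)%g x = (t ^+ i)%g x.
  move=> xA; elim: i => [|i IH]; first by rewrite !expg0.
  by rewrite !expgSr !permM -IH st // stable_iter.
have orbE x : x \in A -> porbit s x = porbit t x.
  move=> xA; apply/setP => y.
  by apply/porbitP/porbitP => -[i ->]; exists i; rewrite iterE.
apply/setP => C; rewrite !inE; apply/andP/andP => -[/imsetP[x _ ->] CA].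
  have xA := subsetP CA _ (porbit_id s x).
  by rewrite orbE // in CA *; rewrite imset_f.
have xA := subsetP CA _ (porbit_id t x).
by rewrite -orbE // in CA *; rewrite imset_f.
Qed.

Lemma perm_on_stable s S : perm_on S s -> stable s S.
Proof. by move=> sS; apply/stableP => x; rewrite perm_closed. Qed.

Section CycleSum.
Variables (K : comNzRingType) (e : rel T).
Hypothesis e_refl : reflexive e.
Implicit Type w : nat -> K.

Definition follows s := [forall x, e x (s x)].

Definition cycle_weight w s A := \prod_(C in cycles_in s A) w #|C|.

Definition cycle_sum w S := \sum_(s | perm_on S s && follows s) cycle_weight w s S.

(** Expanding the product picks one of the two weights for each cycle inside [S]. The set of cycles
    given [w1] and its union [A] determine each other, through [cover] and [cycles_in s]. *)
Lemma cycle_weightD w1 w2 s S :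
  cycle_weight (fun l => w1 l + w2 l) s S =
  \sum_(A : {set T} | (A \subset S) && stable s A)
     cycle_weight w1 s A * cycle_weight w2 s (S :\: A).
Proof.
rewrite /cycle_weight prod_add_subset.
rewrite (reindex_onto (cycles_in s) (@cover T)) /= => [|J JS]; last first.
  by rewrite cycles_in_cover // (subset_trans JS) //; apply/subsetP => C /setIdP[].
apply: eq_big => [A|A /andP[AS sA]]; last first.
  have sA' : stable s A.
    rewrite -(eqP sA); apply: stable_cover.
    by apply/subsetP => C /setIdP[].
  rewrite cycles_inD // -{1}(cover_cycles_in sA').
  apply: subset_trans (_ : cover (cycles_in s S) \subset S).
    by apply/bigcupsP => C CA; apply: bigcup_sup; apply: (subsetP AS).
  by apply/bigcupsP => C /setIdP[].
apply/andP/andP => [[AS /eqP sA]|[AS sA]]; last first.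
  by rewrite cover_cycles_in // cycles_in_sub.
rewrite -sA; split.
  by apply/bigcupsP => C CA; have /setIdP[] := subsetP AS _ CA.
by apply: stable_cover; apply/subsetP => C /setIdP[].
Qed.

(** A permutation of [S] preserving [A] is a product of a permutation of [A] and one of its
    complement in [S], recovered by [restr_perm]. Following [e] is a pointwise condition, and
    reflexivity covers the points that a factor fixes. *)
Lemma cycle_sum_split w1 w2 A S : A \subset S ->
  \sum_(s | (perm_on S s && follows s) && stable s A)
     cycle_weight w1 s A * cycle_weight w2 s (S :\: A) =
  cycle_sum w1 A * cycle_sum w2 (S :\: A).
Proof.
move=> AS; pose B := S :\: A.
have disjAB x : x \in B -> x \notin A by case/setDP.
have stN s X : stable s X -> s \in ('N(X | 'P))%g.
  by move/stableP=> sX; apply/astabsP => x; apply: sX.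
have stB s : perm_on S s -> stable s A -> stable s B.
  move=> sS /stableP sA; apply/stableP => x.
  by rewrite !inE sA (perm_closed _ sS).
have actA (s1 s2 : {perm T}) x : perm_on A s1 -> perm_on B s2 -> x \in A -> (s1 * s2)%g x = s1 x.
  move=> s1A s2B xA; rewrite permM (out_perm s2B) //.
  by apply/negP => /disjAB; rewrite perm_closed // xA.
have actB (s1 s2 : {perm T}) x : perm_on A s1 -> perm_on B s2 -> x \notin A -> (s1 * s2)%g x = s2 x.
  by move=> s1A s2B xA; rewrite permM (out_perm s1A).
rewrite /cycle_sum big_distrlr /= pair_big /=.
rewrite (reindex_onto (fun p : {perm T} * {perm T} => (p.1 * p.2)%g)
          (fun s => (restr_perm A s, restr_perm B s))) /=; last first.
  move=> s /andP[/andP[sS _] sA]; apply/permP => x.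
  have [xA|xA] := boolP (x \in A).
    by rewrite actA ?restr_perm_on // restr_permE // stN.
  rewrite actB ?restr_perm_on //; have [xB|xB] := boolP (x \in B).
    by rewrite restr_permE // stN // stB.
  rewrite (out_perm (restr_perm_on _ _)) // (out_perm sS) //.
  by apply: contra xB; rewrite inE xA.
apply: eq_big => [[s1 s2] /=|[s1 s2] /= /andP[/andP[/andP[sS _] sA] /eqP[s1E s2E]]]; last first.
  congr (_ * _); rewrite /cycle_weight.
    rewrite -[in RHS]s1E (@eq_cycles_in _ (restr_perm A (s1 * s2)%g)) // => x xA.
    by rewrite restr_permE // stN.
  rewrite -[in RHS]s2E (@eq_cycles_in _ (restr_perm B (s1 * s2)%g)) //; first exact: stB.
  by move=> x xA; rewrite restr_permE // stN // stB.
apply/idP/idP.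
  case/andP=> /andP[/andP[sS /forallP sF] sA] /eqP[s1E s2E].
  have s1A : perm_on A s1 by rewrite -s1E restr_perm_on.
  have s2B : perm_on B s2 by rewrite -s2E restr_perm_on.
  rewrite s1A s2B /=; apply/andP; split; apply/forallP => x.
    have [xA|xA] := boolP (x \in A); last by rewrite (out_perm s1A).
    by rewrite -(actA _ _ _ s1A s2B).
  have [xB|xB] := boolP (x \in B); last by rewrite (out_perm s2B).
  by rewrite -(actB _ _ _ s1A s2B) // disjAB.
case/andP=> /andP[s1A /forallP F1] /andP[s2B /forallP F2].
have sA : stable (s1 * s2)%g A.
  apply/stableP => x; have [xA|xA] := boolP (x \in A).
    by rewrite actA // perm_closed.
  rewrite actB //; have [xB|xB] := boolP (x \in B).
    by apply/negbTE/disjAB; rewrite perm_closed.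
  by rewrite (out_perm s2B) // (negPf xA).
have sS : perm_on S (s1 * s2)%g.
  apply: perm_onM; apply/subsetP => x xs.
    exact: (subsetP AS) (subsetP s1A _ xs).
  by have /setDP[] := subsetP s2B _ xs.
rewrite sA sS /= andbT; apply/andP; split.
  apply/forallP => x; have [xA|xA] := boolP (x \in A); first by rewrite actA.
  by rewrite actB.
rewrite xpair_eqE; apply/andP; split; apply/eqP/permP => x.
  have [xA|xA] := boolP (x \in A); first by rewrite restr_permE ?actA // stN.
  by rewrite !(out_perm _ xA) // restr_perm_on.
have [xB|xB] := boolP (x \in B).
  by rewrite restr_permE ?stN ?stB // actB // disjAB.
by rewrite !(out_perm _ xB) // restr_perm_on.
Qed.

Lemma cycle_sumD w1 w2 S :
  cycle_sum (fun l => w1 l + w2 l) S =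
  \sum_(A : {set T} | A \subset S) cycle_sum w1 A * cycle_sum w2 (S :\: A).
Proof.
rewrite {1}/cycle_sum; under eq_bigr => s _ do rewrite cycle_weightD.
rewrite (exchange_big_dep (fun A => A \subset S)) /= => [|s A _ /andP[] //].
apply: eq_bigr => A AS; rewrite -cycle_sum_split //.
by apply: eq_bigl => s; rewrite AS.
Qed.

Lemma eq_cycle_sum w1 w2 S : w1 =1 w2 -> cycle_sum w1 S = cycle_sum w2 S.
Proof.
by move=> ww; apply: eq_bigr => s _; apply: eq_bigr => C _; rewrite ww.
Qed.

(** A nonempty [S] contains a cycle, whose weight is 0. The zero weight thus gives the unit for the
    product of [cycle_sumD]. *)
Lemma cycle_sum0 S : cycle_sum (fun=> 0) S = (S == set0)%:R.
Proof.
have [->|/set0Pn[x xS]] := eqVneq S set0; last first.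
  apply: big1 => s /andP[sS _]; rewrite /cycle_weight (bigD1 (porbit s x)) /= ?mul0r //.
  by rewrite in_set imset_f //= porbit_sub // perm_on_stable.
rewrite /cycle_sum (big_pred1 1%g) => [|s]; last first.
  apply/andP/eqP => [[s0 _]|->].
    by apply/permP => x; rewrite (out_perm s0) ?inE // perm1.
  by rewrite perm_on1; split=> //; apply/forallP => x; rewrite perm1.
rewrite /cycle_weight big1 // => C; rewrite inE subset0 => /andP[C1 /eqP C0].
by have [x] := porbits_neq0 C1; rewrite C0 inE.
Qed.

(** The signature of a cycle of length [l]. *)
Definition sign_weight (l : nat) : K := - (-1) ^+ l.

Lemma cycle_weight_sign s S : perm_on S s -> cycle_weight sign_weight s S = (-1) ^+ s.
Proof.
move=> sS; have sT : stable s setT by apply/stableP => x; rewrite !inE.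
(* Points outside [S] are fixed, of weight [sign_weight 1 = 1], so all cycles of [s] may be
   included; [odd_perm] is defined from their number and #|T|. *)
have -> : cycle_weight sign_weight s S = cycle_weight sign_weight s setT.
  rewrite /cycle_weight [RHS](big_setID (cycles_in s S)) /=.
  rewrite (setIidPr (cycles_in_sub s (subsetT S))).
  rewrite cycles_inD ?perm_on_stable // [X in _ * X]big1 ?mulr1 // => C.
  rewrite inE subsetD => /andP[/imsetP[x _ ->] /andP[_ dx]].
  have xS := disjointFr dx (porbit_id s x).
  have fx : s x = x by apply: (out_perm sS); rewrite xS.
  suff -> : porbit s x = [set x] by rewrite cards1 /sign_weight expr1 opprK.
  apply/setP => y; rewrite inE; apply/porbitP/eqP => [[i ->]|->].
    by elim: i => [|i IH]; rewrite ?perm1 // expgSr permM IH.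
  by exists 0%N; rewrite perm1.
rewrite /cycle_weight /sign_weight; under eq_bigr => C _ do rewrite -mulN1r.
rewrite big_split /= prodr_const -expr_sum card_cycles_in // cardsT.
have -> : cycles_in s setT = porbits s by apply/setP => C; rewrite inE subsetT andbT.
by rewrite -[X in X * _]signr_odd -[X in _ * X]signr_odd -signr_addb /odd_perm addbC.
Qed.

Lemma cycle_sum_sign S :
  cycle_sum sign_weight S = \sum_(s | perm_on S s && follows s) (-1) ^+ s.
Proof. by apply: eq_bigr => s /andP[sS _]; apply: cycle_weight_sign. Qed.

(** The constant -1 is (-1)^l times [sign_weight l], and the cycle lengths add up to #|S|. *)
Lemma cycle_sumN1 S : cycle_sum (fun=> -1) S = (-1) ^+ #|S| * cycle_sum sign_weight S.
Proof.
rewrite mulr_sumr; apply: eq_bigr => s /andP[sS _].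
rewrite -(card_cycles_in (perm_on_stable sS)) -prodrXr.
rewrite /cycle_weight -big_split; apply: eq_bigr => C _ /=.
by rewrite /sign_weight mulrN -expr2 sqrr_sign.
Qed.

End CycleSum.
End Cycles.

(** * Weak exceedances on row labels, weak deficiencies on column labels *)

Lemma sum_subsets_by_card (K : comNzRingType) (T : finType) (B : {set T}) (f : nat -> K) :
  \sum_(A : {set T} | A \subset B) f #|A| =
  \sum_(a < #|B|.+1) 'C(#|B|, a)%:R * f a.
Proof.
rewrite (partition_big (fun A : {set T} => inord #|A| : 'I_#|B|.+1) predT) //=.
apply: eq_bigr => a _; rewrite -(cards_draws B a) -[X in X%:R]sum1_card natr_sum mulr_suml.
apply: eq_big => [A|A /andP[AB /eqP <-]]; last first.
  by rewrite mul1r inordK // ltnS subset_leq_card.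
rewrite inE; apply: andb_id2l => AB.
by rewrite -val_eqE /= inordK // ltnS subset_leq_card.
Qed.

Lemma sum_subsets_setU (K : comNzRingType) (T : finType) (X S : {set T})
    (f : {set T} -> {set T} -> K) :
  \sum_(A : {set T} | A \subset S) f (A :&: X) (A :\: X) =
  \sum_(A : {set T} | A \subset S :&: X)
    \sum_(B : {set T} | B \subset S :\: X) f A B.
Proof.
rewrite pair_big /= (reindex_onto (fun A : {set T} => (A :&: X, A :\: X))
  (fun p : {set T} * {set T} => p.1 :|: p.2)) /= => [|[A B] /=]; last first.
  rewrite !subsetI !subsetD => /andP[/andP[AS AX] /andP[BS BX]].
  have BX0 : B :&: X = set0 by apply: disjoint_setI0.
  rewrite setIUl setDUl BX0 setU0 (setIidPl AX) (setDidPl BX).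
  by have /eqP-> : A :\: X == set0; rewrite ?set0U // setD_eq0.
apply: eq_bigl => A; rewrite setID eqxx andbT.
apply/idP/andP => [AS|[AIS ADS]]; first by rewrite setSI ?setSD.
by rewrite -(setID A X) subUset (subset_trans AIS) ?subsetIl // (subset_trans ADS) ?subsetDl.
Qed.

Section EgfProduct.
Variables (t : rat) (T : finType) (X : {set T}).
Implicit Types (g : {set T} -> rat) (f : fps) (S : {set T}).

(** A bivariate exponential generating function: x marks the elements of [X], y the others, and the
    polynomial coefficients are evaluated at [t]. *)
Definition has_egf g f := forall S,
  g S = (#|S :&: X|`! * #|S :\: X|`!)%:R * (f #|S :&: X| #|S :\: X|).[t].

(** With a elements of [S] in [X] and b outside, C(a,i) C(b,j) subsets have i and j such elements;
    the binomials turn the factorials of the two factors into a! b!. *)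
Lemma has_egf_mul g1 g2 f1 f2 : has_egf g1 f1 -> has_egf g2 f2 ->
  has_egf (fun S => \sum_(A : {set T} | A \subset S) g1 A * g2 (S :\: A)) (fmul f1 f2).
Proof.
move=> gf1 gf2 S; set a := #|_|; set b := #|S :\: X|.
pose c i j := (i`! * j`!)%:R * (f1 i j).[t] *
  (((a - i)`! * (b - j)`!)%:R * (f2 (a - i)%N (b - j)%N).[t]).
transitivity (\sum_(A : {set T} | A \subset S) c #|A :&: X| #|A :\: X|).
  apply: eq_bigr => A AS; rewrite gf1 gf2 /c.
  have -> : #|(S :\: A) :&: X| = (a - #|A :&: X|)%N.
    rewrite -cardsDS ?setSI //; apply: eq_card => x; rewrite !inE.
    by case: (x \in A); case: (x \in X); case: (x \in S).
  have -> // : #|(S :\: A) :\: X| = (b - #|A :\: X|)%N.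
  rewrite -cardsDS ?setSD //; apply: eq_card => x; rewrite !inE.
  by case: (x \in A); case: (x \in X); case: (x \in S).
rewrite (sum_subsets_setU _ _ (fun A B => c #|A| #|B|)).
under eq_bigr => A _ do rewrite sum_subsets_by_card.
rewrite (sum_subsets_by_card _ (fun i => \sum_(j < _) _ * c i j)) -/a -/b.
rewrite /fmul horner_sum mulr_sumr; apply: eq_bigr => i _.
rewrite horner_sum !mulr_sumr; apply: eq_bigr => j _.
rewrite hornerM /c -(bin_fact (ltn_ord i : (i <= a)%N)).
rewrite -(bin_fact (ltn_ord j : (j <= b)%N)) !natrM; ring.
Qed.

End EgfProduct.

Section SignSum.
Variables (N m : nat).
Implicit Types (s : {perm 'I_N}) (S : {set 'I_N}).

Definition weakly_exceeds : rel 'I_N := fun k l => if (k < m)%N then (k <= l)%N else (l <= k)%N.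

Definition rows : {set 'I_N} := [set k : 'I_N | (k < m)%N].

Lemma weakly_exceeds_refl : reflexive weakly_exceeds.
Proof. by move=> k; rewrite /weakly_exceeds; case: ifP. Qed.

(** The sums of all k and of all s k are equal, so no inequality is strict. *)
Lemma perm_ge_id s : (forall k : 'I_N, k <= s k)%N -> s = 1%g.
Proof.
move=> s_ge.
have := @leqif_sum _ predT (fun k : 'I_N => k == s k :> nat)
  (fun k : 'I_N => k : nat) (fun k : 'I_N => s k : nat) (fun k _ => leqif_eq (s_ge k)).
case=> _; rewrite -(reindex_inj (@perm_inj _ s) (P := predT) (F := fun k : 'I_N => k : nat)) eqxx.
move/esym/forallP => s_eq; apply/permP => k; rewrite perm1.
by apply/esym/val_inj/eqP/s_eq.
Qed.

Lemma perm_le_id s : (forall k : 'I_N, s k <= k)%N -> s = 1%g.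
Proof.
move=> s_le; apply: invg_inj; rewrite invg1; apply: perm_ge_id => k.
by rewrite -{1}[k](permKV s).
Qed.

Lemma follows_sign_mono S s : (S \subset rows) || [disjoint S & rows] ->
  (perm_on S s && follows weakly_exceeds s) = (s == 1%g).
Proof.
move=> mono; apply/andP/eqP => [[sS /forallP sF]|->]; last first.
  by rewrite perm_on1; split=> //; apply/forallP => x; rewrite perm1 weakly_exceeds_refl.
case/orP: mono => [/subsetP SX|SX].
  apply: perm_ge_id => k; have [kS|kS] := boolP (k \in S); last by rewrite (out_perm sS).
  by have := sF k; rewrite /weakly_exceeds; have := SX _ kS; rewrite inE => ->.
apply: perm_le_id => k; have [kS|kS] := boolP (k \in S); last by rewrite (out_perm sS).
by have := sF k; rewrite /weakly_exceeds; have := disjointFr SX kS; rewrite inE => ->.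
Qed.

(* The largest row r and the smallest column c of S are admissible values at
   every position of S, so exchanging these two values reverses signs. *)
Lemma follows_sign_mixed (S : {set 'I_N}) (r0 c0 : 'I_N) :
    r0 \in S :&: rows -> c0 \in S :\: rows ->
  \sum_(s | perm_on S s && follows weakly_exceeds s) (-1) ^+ s = 0 :> rat.
Proof.
move=> r0S c0S.
have [r rS r_max] : exists2 r, r \in S :&: rows & forall k, k \in S :&: rows -> (k <= r)%N.
  case: (@arg_maxnP _ r0 [in S :&: rows] (fun k => k : nat)) => // r rS rmax.
  by exists r.
have [c cS c_min] : exists2 c, c \in S :\: rows & forall k, k \in S :\: rows -> (c <= k)%N.
  case: (@arg_minnP _ c0 [in S :\: rows] (fun k => k : nat)) => // c cS cmin.
  by exists c.
have all_ok k z : k \in S -> z \in [set r; c] -> weakly_exceeds k z.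
  move: (rS) (cS); rewrite !inE /weakly_exceeds => /andP[rS' rm] /andP[cm cS'] kS.
  have [km|km] := ltnP k m.
    have rk : (k <= r)%N by apply: r_max; rewrite !inE kS.
    by case/orP=> /eqP-> //; lia.
  have ck : (c <= k)%N by apply: c_min; rewrite !inE kS -leqNgt km.
  by case/orP=> /eqP-> //; lia.
have [{}rS rm] := setIP rS; have [{}cS cm] := setDP cS.
have rc : r != c by apply: contraNneq cm => <-.
pose t := tperm r c.
have tS : perm_on S t.
  by apply: subset_trans (tperm_on r c) _; apply/subsetP => z /set2P[]->.
have stepP s : perm_on S s && follows weakly_exceeds s ->
    perm_on S (s * t)%g && follows weakly_exceeds (s * t)%g.
  case/andP=> sS /forallP sF; rewrite perm_onM //; apply/forallP => k.
  rewrite permM; have [kS|kS] := boolP (k \in S); last first.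
    by rewrite (out_perm sS) // (out_perm tS) // weakly_exceeds_refl.
  by rewrite /t; case: tpermP => // _; apply: all_ok; rewrite // !inE eqxx ?orbT.
set Q := BIG_P; have QE s : Q (s * t)%g = Q s.
  apply/idP/idP => [/stepP|]; last exact: stepP.
  by rewrite -mulgA tperm2 mulg1.
set sg := \sum_(s | _) _; suff : sg = - sg by move=> sgN; lra.
rewrite {1}/sg (reindex_inj (mulIg t)) (eq_bigl Q) // -sumrN.
by apply: eq_bigr => s _; rewrite odd_permM odd_tperm rc addbT signrN.
Qed.

Lemma cycle_sum_sign_exceeds S :
  cycle_sum weakly_exceeds (@sign_weight rat) S =
  ((#|S :&: rows| == 0%N) || (#|S :\: rows| == 0%N))%:R.
Proof.
rewrite cycle_sum_sign !cards_eq0 setD_eq0 setI_eq0 orbC.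
have [mono|] := boolP (_ || _).
  rewrite (big_pred1 1%g) ?odd_perm1 ?expr0 // => s.
  exact: follows_sign_mono.
rewrite negb_or => /andP[/subsetPn[c cS cX] /pred0Pn[r /andP[/= rS rX]]].
by apply: (@follows_sign_mixed _ r c); rewrite inE ?rS ?cX.
Qed.

Lemma coef_Gpos t i j :
  (i`! * j`!)%:R * (Gpos i j).[t] = ((i == 0%N) || (j == 0%N))%:R.
Proof.
rewrite /Gpos /fsub /fadd /fexpx /fexpy /fone !expr1n natrM.
have f0 k : (k`!)%:R != 0 :> rat by rewrite pnatr_eq0 -lt0n fact_gt0.
case: (eqVneq i 0%N) => [->|i0]; case: (eqVneq j 0%N) => [->|j0] /=;
  rewrite !hornerE /= ?mulr0 //; by field; rewrite ?f0.
Qed.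

(** [Gneg] is [Gpos] with x and y replaced by -x and -y. *)
Lemma coef_Gneg i j : Gneg i j = (-1) ^+ (i + j) * Gpos i j.
Proof.
rewrite /Gpos /Gneg /fsub /fadd /fexpx /fexpy /fone !expr1n.
case: (eqVneq i 0%N) => [->|i0]; case: (eqVneq j 0%N) => [->|j0] /=.
- by rewrite addn0 !expr0 !mul1r.
- by rewrite add0n addr0 add0r !subr0 polyCM polyC_exp polyCN polyC1 mul1r.
- by rewrite addn0 addr0 add0r !subr0 polyCM polyC_exp polyCN polyC1 mul1r.
- by rewrite addr0 subrr mulr0.
Qed.

Section Egf.
Variable t : rat.
Notation has_egf := (has_egf t rows).
Notation cycle_sum := (cycle_sum weakly_exceeds).

Lemma egf_sign : has_egf (cycle_sum (@sign_weight rat)) Gpos.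
Proof. by move=> S; rewrite cycle_sum_sign_exceeds coef_Gpos. Qed.

Lemma egf_N1 : has_egf (cycle_sum (fun=> -1)) Gneg.
Proof.
move=> S; rewrite cycle_sumN1 egf_sign coef_Gneg cardsID hornerM mulrCA.
by congr (_ * _); rewrite -signr_odd -[in RHS]signr_odd; case: odd; rewrite !hornerE.
Qed.

Lemma egf_pow (w : nat -> rat) (f : fps) k :
  has_egf (cycle_sum w) f -> has_egf (cycle_sum (fun l => w l *+ k)) (fpow f k).
Proof.
move=> wf; elim: k => [|k IH] S /=.
  rewrite (@eq_cycle_sum _ _ _ _ (fun=> 0)) // cycle_sum0; last exact: weakly_exceeds_refl.
  rewrite -cards_eq0 -(cardsID rows S) addn_eq0 /fone.
  by do 2 case: eqP => [->|_]; rewrite !hornerE /= ?mulr0.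
rewrite -(has_egf_mul wf IH) -cycle_sumD; last exact: weakly_exceeds_refl.
by apply: eq_cycle_sum => l; rewrite mulrS.
Qed.

(** On odd lengths the two weights give -k + (k+1) = 1, on even ones -k - (k+1) = -(2k+1). *)
Lemma egf_parity_weight k :
  has_egf (cycle_sum (fun l => if odd l then 1 else - (k.*2.+1)%:R))
    (fmul (fpow Gneg k) (fpow Gpos k.+1)).
Proof.
move=> S; rewrite -(has_egf_mul (egf_pow k egf_N1) (egf_pow k.+1 egf_sign)) -cycle_sumD.
  apply: eq_cycle_sum => l; rewrite /sign_weight -signr_odd.
  case: odd; rewrite ?expr0 ?expr1 ?opprK !mulNrn.
    by rewrite mulrS addrCA addNr addr0.
  by rewrite -addnn -addnS natrD opprD.
exact: weakly_exceeds_refl.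
Qed.

End Egf.
End SignSum.

(** * Cauchon diagrams and their toric permutations *)

Section PipeDreams.
Variables m' n : nat.
Local Notation m := m'.+1.
Local Notation label := 'I_(m'.+1 + n).
Implicit Types (i j p q : nat) (k r x y : label) (w : nat -> nat -> bool) (v : nat -> bool).
Local Open Scope group_scope.
Local Open Scope nat_scope.

Definition label0 : label := @Ordinal (m'.+1 + n) 0 isT.
(** Labels are shifted to start at 0, so row [i] from the top, labelled m - i, has value m' - i. The
    default [label0] is reached only by columns out of range. *)
Definition row_label i : label := insubd label0 (m' - i).
Definition col_label j : label := insubd label0 (m + j).

Lemma val_row i : row_label i = m' - i :> nat.
Proof. by rewrite val_insubd; case: ifP => //; lia. Qed.

Lemma val_col j : j < n -> col_label j = m + j :> nat.
Proof. by move=> jn; rewrite val_insubd; case: ifP => //; lia. Qed.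

Lemma row_labelK x : x < m -> x = row_label (m' - x).
Proof. by move=> xm; apply: val_inj => /=; rewrite val_row; lia. Qed.

Lemma col_labelK x : m <= x -> x - m < n /\ x = col_label (x - m).
Proof.
move=> xm; have := ltn_ord x => xN; have jn : x - m < n by lia.
by split=> //; apply: val_inj => /=; rewrite val_col //; lia.
Qed.

Lemma row_col_neq i j : j < n -> row_label i != col_label j.
Proof. by move=> jn; apply/eqP => /(congr1 val) /=; rewrite val_row val_col //; lia. Qed.

Lemma col_label_eq i j : i < n -> j < n -> (col_label i == col_label j) = (i == j).
Proof. by move=> ni nj; rewrite -(inj_eq val_inj) /= !val_col // eqn_add2l. Qed.

Lemma row_label_neq i j : i < j <= m' -> row_label i != row_label j.
Proof. by move=> ij; apply/eqP => /(congr1 val) /=; rewrite !val_row; lia. Qed.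

(* v marks the white squares of a row, and row_cycle r v q is the effect of its
   first q squares on the pipes: the one running along the row and entering
   square q - 1 from the right, and those entering from below. *)
Fixpoint row_cycle r v q : {perm label} :=
  if q is q'.+1 then ((if v q' then tperm r (col_label q') else 1) * row_cycle r v q')%g
  else 1%g.

(** A pipe going left from column [q] crosses black squares and turns up at the first white one it
    meets, the rightmost before [q]; if there is none it exits at the left end [r]. *)
Fixpoint last_white r v q : label :=
  if q is q'.+1 then if v q' then col_label q' else last_white r v q' else r.

Lemma last_white_cases r v q :
  (last_white r v q = r /\ forall j, j < q -> ~~ v j) \/
  exists j, [/\ j < q, v j, last_white r v q = col_label j &
    forall j', j < j' < q -> ~~ v j'].
Proof.
elim: q => [|q [[IHr IH]|[j [jq vj IHj IH]]]] /=; first by left.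
  case vq: (v q); last first.
    left; split=> // j; rewrite ltnS leq_eqVlt => /orP[/eqP->|/IH//].
    by rewrite vq.
  by right; exists q; split=> // j'; lia.
case vq: (v q); right.
  by exists q; split=> // j'; lia.
exists j; split=> // [|j' /andP[jj']]; first exact: ltnW.
rewrite ltnS leq_eqVlt => /orP[/eqP->|j'q]; first by rewrite vq.
by apply: IH; rewrite jj'.
Qed.

Lemma row_cycle_fix r v q x :
  x != r -> (forall j, j < q -> v j -> x != col_label j) -> row_cycle r v q x = x.
Proof.
move=> xr; elim: q => [|q IH] xc /=; first by rewrite perm1.
rewrite permM; have -> : (if v q then tperm r (col_label q) else 1%g) x = x.
  case: ifP => [vq|]; last by rewrite perm1.
  by rewrite tpermD // eq_sym // xc.
by apply: IH => j jq; apply: xc; apply: ltnW.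
Qed.

Section Row.
Variable i : nat.
Local Notation r := (row_label i).

Lemma row_cycle_row v q : q <= n -> row_cycle r v q r = last_white r v q.
Proof.
elim: q => [|q IH] qn /=; first by rewrite perm1.
rewrite permM; case: ifP => vq; last by rewrite perm1 IH // ltnW.
rewrite tpermL row_cycle_fix // => [|j jq _]; first by rewrite eq_sym row_col_neq.
by rewrite col_label_eq ?(ltn_trans jq) // gtn_eqF.
Qed.

Lemma row_cycle_col v q j : j < q -> q <= n ->
  row_cycle r v q (col_label j) = if v j then last_white r v j else col_label j.
Proof.
elim: q => // q IH jq qn; rewrite permM.
move: jq; rewrite ltnS leq_eqVlt => /orP[/eqP->|jq].
  case: ifP => vq; first by rewrite tpermR row_cycle_row // ltnW.
  rewrite perm1 row_cycle_fix // => [|j' j'q _]; first by rewrite eq_sym row_col_neq.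
  by rewrite col_label_eq ?(ltn_trans j'q) // gtn_eqF.
have jn : j < n := ltn_trans jq qn.
have -> : (if v q then tperm r (col_label q) else 1%g) (col_label j) = col_label j.
  case: ifP => _; last by rewrite perm1.
  by rewrite tpermD ?row_col_neq ?col_label_eq // gtn_eqF.
by rewrite IH // ltnW.
Qed.

Lemma row_cycle_other v q x : q <= n -> x < m -> x != r -> row_cycle r v q x = x.
Proof.
move=> qn xm xr; apply: row_cycle_fix => // j jq _.
by rewrite (row_labelK xm) row_col_neq // (leq_trans jq).
Qed.

End Row.

(** The effect of the top [p] rows; pipes travel upwards, so the lowest of them acts first. *)
Fixpoint pipe_perm w p : {perm label} :=
  if p is p'.+1 then (row_cycle (row_label p') (w p') n * pipe_perm w p')%g else 1%g.

Lemma eq_row_cycle r v1 v2 q : (forall j, j < q -> v1 j = v2 j) ->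
  row_cycle r v1 q = row_cycle r v2 q.
Proof.
elim: q => //= q IH v12; rewrite v12 // IH // => j jq.
by apply: v12; apply: ltnW.
Qed.

Lemma eq_pipe_perm w1 w2 p : (forall i j, i < p -> j < n -> w1 i j = w2 i j) ->
  pipe_perm w1 p = pipe_perm w2 p.
Proof.
elim: p => //= p IH w12; rewrite IH => [|i j ip jn]; last by rewrite w12 // ltnW.
by congr (_ * _)%g; apply: eq_row_cycle => j jn; apply: w12.
Qed.

Lemma pipe_perm_low w p k : k + p < m -> pipe_perm w p k = k.
Proof.
elim: p => [|p IH] kp /=; first by rewrite perm1.
rewrite permM row_cycle_other ?IH //; first by lia.
  by lia.
by apply/eqP => /(congr1 val) /=; rewrite val_row; lia.
Qed.

Lemma pipe_perm_row_fix w p i : p <= i <= m' -> pipe_perm w p (row_label i) = row_label i.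
Proof. by move=> ip; rewrite pipe_perm_low // val_row; lia. Qed.

Lemma pipe_perm_col w p j : j < n -> pipe_perm w p.+1 (col_label j) =
  pipe_perm w p (if w p j then last_white (row_label p) (w p) j else col_label j).
Proof. by move=> jn; rewrite permM row_cycle_col. Qed.

Lemma pipe_perm_row w p i : i < p <= m -> pipe_perm w p (row_label i) =
  pipe_perm w i (last_white (row_label i) (w i) n).
Proof.
elim: p => // p IH /andP[]; rewrite ltnS leq_eqVlt => /orP[/eqP->|ip] pm.
  by rewrite permM row_cycle_row.
rewrite permM row_cycle_other ?row_label_neq ?val_row ?IH ?ip ?(ltnW pm) //.
by lia.
Qed.

Lemma pipe_perm_exceeds w p x : p <= m -> weakly_exceeds m x (pipe_perm w p x).
Proof.
elim: p x => [|p IH] x pm; first by rewrite perm1 weakly_exceeds_refl.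
have {}IH y := IH y (ltnW pm); rewrite /weakly_exceeds; case: ifP => xm.
  have [xr|xr] := eqVneq x (row_label p); last first.
    by rewrite permM row_cycle_other //; have := IH x; rewrite /weakly_exceeds xm.
  (* A smaller image would be the label of a row further down, which is already a fixed point,
     against injectivity. *)
  rewrite leqNgt; apply/negP => lt_x.
  have low : pipe_perm w p.+1 (pipe_perm w p.+1 x) = pipe_perm w p.+1 x.
    by apply: pipe_perm_low; move: lt_x; rewrite {2}xr val_row; lia.
  by move/perm_inj: low lt_x => ->; rewrite ltnn.
have [jn xE] : x - m < n /\ x = col_label (x - m) by apply: col_labelK; lia.
rewrite xE pipe_perm_col // val_col //.
have col_le j : j <= x - m -> pipe_perm w p (col_label j) <= m + (x - m).
  move=> jx; have jn' := leq_ltn_trans jx jn.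
  have := IH (col_label j); rewrite /weakly_exceeds val_col //; case: ifP; lia.
case: ifP => _; last exact: col_le.
have [[-> _]|[j [jx _ -> _]]] := last_white_cases (row_label p) (w p) (x - m).
  by rewrite pipe_perm_row_fix ?val_row; lia.
by apply/col_le/ltnW.
Qed.

Lemma pipe_perm_col_le w p j : p <= m -> j < n -> pipe_perm w p (col_label j) <= m + j.
Proof.
move=> pm jn; have := pipe_perm_exceeds w (col_label j) pm.
by rewrite /weakly_exceeds val_col //; case: ifP; lia.
Qed.

Lemma pipe_perm_col_lt w p j : p < m -> j < n -> w p j ->
  pipe_perm w p.+1 (col_label j) < m + j.
Proof.
move=> pm jn wj; rewrite pipe_perm_col // wj.
have [[-> _]|[j' [j'j _ -> _]]] := last_white_cases (row_label p) (w p) j.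
  by rewrite pipe_perm_row_fix ?val_row; lia.
by have := @pipe_perm_col_le w p j' (ltnW pm) (ltn_trans j'j jn); lia.
Qed.

(** A white square turns the pipe left, to a smaller label, and by [pipe_perm_col_le] no higher row
    brings it back to column [j]. *)
Lemma pipe_perm_col_fix w p j : p <= m -> j < n ->
  (pipe_perm w p (col_label j) = col_label j) <-> (forall i, i < p -> ~~ w i j).
Proof.
move=> pm jn; elim: p pm => [|p IH] pm; first by rewrite perm1.
have {}IH := IH (ltnW pm); split=> [fixj|black]; last first.
  rewrite pipe_perm_col // (negPf (black p _)) //; apply/IH => i ip.
  by apply: black; apply: ltnW.
have wj : ~~ w p j.
  by apply/negP => /(pipe_perm_col_lt pm jn); rewrite fixj val_col // ltnn.
rewrite pipe_perm_col // (negPf wj) in fixj.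
by move=> i; rewrite ltnS leq_eqVlt => /orP[/eqP->//|]; apply: (IH.1 fixj).
Qed.

(** The white squares of the lowest row, read off from the permutation: the leftmost is over the
    column sent to [r], the others are over the later columns that move. *)
Definition white_from (s : {perm label}) r j :=
  (s (col_label j) == r) ||
  [exists j0 : 'I_n, [&& j0 < j, s (col_label j0) == r & s (col_label j) != col_label j]].

Definition cauchon_rows w p := forall i j, i < p -> j < n -> ~~ w i j ->
  (forall i', i' < i -> ~~ w i' j) \/ (forall j', j' < j -> ~~ w i j').

Lemma cauchon_rowsW w p : cauchon_rows w p.+1 -> cauchon_rows w p.
Proof. by move=> cw i j ip; apply: cw; apply: ltnW. Qed.

(** The pipe entering the leftmost white square from below exits at the row's left end. Right of it,
    a black square has a white one to its left, so the Cauchon condition makes the column above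
    black and its label fixed, whereas a white square moves the label. *)
Lemma white_fromE w p j : p < m -> cauchon_rows w p.+1 -> j < n ->
  w p j = white_from (pipe_perm w p.+1) (row_label p) j.
Proof.
move=> pm cw jn; set s := pipe_perm w p.+1; set r := row_label p.
have sr (k : nat) : k < n -> (s (col_label k) == r) = w p k && (last_white r (w p) k == r).
  move=> kn; rewrite /s pipe_perm_col //.
  have rfix : pipe_perm w p r = r by apply: pipe_perm_row_fix; lia.
  rewrite -[X in _ == X]rfix (inj_eq perm_inj); case: ifP => // _.
  by rewrite eq_sym (negPf (row_col_neq _ kn)).
apply/idP/orP => [wj|[|/existsP[j0 /and3P[j0j]]]]; first last.
- rewrite sr ?ltn_ord // => /andP[wj0 _]; apply: contraR => wj.
  apply/eqP/pipe_perm_col_fix => // i; rewrite ltnS leq_eqVlt => /orP[/eqP->//|].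
  by have [|black] := cw p j (ltnSn p) jn wj; [apply | rewrite (negPf (black _ j0j)) in wj0].
- by rewrite sr // => /andP[].
have [j0 wj0 j0_min] := ex_minnP (ex_intro (w p) j wj).
have j0j := j0_min _ wj; have j0n := leq_ltn_trans j0j jn.
have sj0 : s (col_label j0) == r.
  rewrite sr // wj0 /=.
  have [[-> _]//|[j1 [j10 /j0_min]]] := last_white_cases r (w p) j0; lia.
move: j0j; rewrite leq_eqVlt => /orP[/eqP<-|j0j]; first by left.
right; apply/existsP; exists (Ordinal j0n); rewrite /= j0j sj0 /=.
by apply/eqP => sj; have := pipe_perm_col_lt pm jn wj; rewrite -/s sj val_col // ltnn.
Qed.

Lemma pipe_perm_inj w1 w2 p : p <= m -> cauchon_rows w1 p -> cauchon_rows w2 p ->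
  pipe_perm w1 p = pipe_perm w2 p -> forall i j, i < p -> j < n -> w1 i j = w2 i j.
Proof.
elim: p => // p IH pm c1 c2 eq12.
have eq_row j : j < n -> w1 p j = w2 p j by move=> jn; rewrite (white_fromE pm c1 jn) (white_fromE pm c2 jn) eq12.
move=> i j; rewrite ltnS leq_eqVlt => /orP[/eqP->|ip]; first exact: eq_row.
apply: IH ip => //; try exact: cauchon_rowsW; first exact: ltnW.
by move: eq12; rewrite /= (eq_row_cycle _ eq_row) => /mulgI.
Qed.

(** * Removing the lowest row from an admissible permutation *)

Section PeelRow.
Variables (p : nat) (s : {perm label}).
Hypotheses (pm : p < m) (s_exc : forall x, weakly_exceeds m x (s x)).
Hypothesis s_low : forall k, k + p.+1 < m -> s k = k.
Local Notation r := (row_label p).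
Local Notation v := (white_from s r).

Lemma white_fromP j : j < n -> v j -> exists2 j1, j1 <= j & s (col_label j1) = r.
Proof.
by move=> jn /orP[/eqP|/existsP[j1 /and3P[/ltnW jj1 /eqP]]]; [exists j | exists j1].
Qed.

Lemma black_after j j1 : j < n -> ~~ v j -> j1 < j -> s (col_label j1) = r ->
  s (col_label j) = col_label j.
Proof.
move=> jn; rewrite negb_or => /andP[_ /existsPn nj] j1j sj1; apply/eqP.
by have := nj (Ordinal (ltn_trans j1j jn)); rewrite /= j1j sj1 eqxx negbK.
Qed.

Lemma first_white j : j < n -> s (col_label j) = r -> last_white r v j = r.
Proof.
move=> jn sj; have [[->]//|[j2 [j2j vj2 _ _]]] := last_white_cases r v j.
have [j1 j12 sj1] := white_fromP (ltn_trans j2j jn) vj2.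
have /eqP := perm_inj (etrans sj1 (esym sj)).
by rewrite col_label_eq; lia.
Qed.

Definition peel : {perm label} := ((row_cycle r v n)^-1 * s)%g.

Lemma peelE x : peel (row_cycle r v n x) = s x.
Proof. by rewrite permM permK. Qed.

Lemma peel_row : peel r = r.
Proof.
pose x := (s^-1)%g r; have sx : s x = r by rewrite permKV.
have [xm|xm] := ltnP x m; last first.
  have [jn xE] := col_labelK xm; rewrite xE in sx.
  rewrite -{2}sx -peelE row_cycle_col // ifT; first by rewrite first_white.
  by rewrite /white_from sx eqxx.
(* A row label sent to [r] is at most [r]; a smaller one would belong to a lower row and be fixed.
   Then no column is sent to [r], so the row is entirely black. *)
have xr : x = r.
  apply/val_inj => /=; have := s_exc x; rewrite /weakly_exceeds xm sx => x_le.
  have [xlow|] := ltnP (x + p.+1) m; first by rewrite -[in RHS]sx s_low.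
  by move: x_le; rewrite val_row; lia.
rewrite xr in sx; rewrite -{2}sx -peelE row_cycle_row //.
have [[->]//|[j [jn vj _ _]]] := last_white_cases r v n.
have [j1 j1j sj1] := white_fromP jn vj.
have /eqP := perm_inj (etrans sj1 (esym sx)).
by rewrite eq_sym (negPf (row_col_neq _ (leq_ltn_trans j1j jn))).
Qed.

Lemma peel_low k : k + p < m -> peel k = k.
Proof.
have [->|kr] := eqVneq k r; first by rewrite peel_row.
move=> kp; have kr' : k <> m' - p :> nat by rewrite -val_row => /val_inj/eqP; apply/negP.
by rewrite -[in LHS](@row_cycle_other p v n k) ?peelE ?s_low //; lia.
Qed.

(** The black columns strictly between [j2] and [q] are fixed by [s], so by injectivity the moved
    point [x] cannot land on one of them. *)
Lemma skip_black x q j2 : q <= n -> j2 < q -> v j2 ->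
    (forall j, j2 < j < q -> ~~ v j) -> s x != x -> s x < m + q -> s x <= m + j2.
Proof.
move=> qn j2q vj2 black sx; have [|sxm] := ltnP (s x) m; first by lia.
have [jn sxE] := col_labelK sxm; move=> sxq; rewrite leqNgt; apply/negP => lt_j2.
have [j1 j12 sj1] := white_fromP (leq_trans j2q qn) vj2.
have fixj : s (col_label (s x - m)) = col_label (s x - m).
  by apply: (black_after jn _ _ sj1); [apply: black|]; lia.
by move: sx; rewrite -(inj_eq (@perm_inj _ s)) {1}sxE fixj -sxE eqxx.
Qed.

(** With [y] the image of [x] under [row_cycle], the value is [s x]. Only [r] and white columns move
    under [row_cycle]; each goes to the previous white column, where [skip_black] supplies the
    sharper bound, or to [r] if there is none. *)
Lemma peel_exceeds y : weakly_exceeds m y (peel y).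
Proof.
rewrite -[y](permKV (row_cycle r v n)) peelE; move: (fun_of_perm _ y) => x.
have [xm|xm] := ltnP x m.
  have [->|xr] := eqVneq x r; last by rewrite row_cycle_other.
  rewrite row_cycle_row //.
  have [[-> _]//|[j2 [j2n vj2 -> black]]] := last_white_cases r v n.
  rewrite /weakly_exceeds val_col // ifF; last by lia.
  have [->|sr] := eqVneq (s r) r; first by rewrite val_row; lia.
  exact: (skip_black (leqnn n)).
have [jn xE] := col_labelK xm; rewrite {1}xE row_cycle_col //.
case: ifP => vj; last by rewrite -xE.
have [[-> none]|[j2 [j2j vj2 -> black]]] := last_white_cases r v (x - m).
  case/orP: vj => [|/existsP[j0 /and3P[j0j sj0 _]]].
    by rewrite -xE => /eqP->; rewrite weakly_exceeds_refl.
  by have := none _ j0j; rewrite /white_from sj0.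
have j2n := ltn_trans j2j jn.
have sx : s x != x.
  case/orP: vj => [|/existsP[j0 /and3P[_ _]]]; rewrite -xE // => /eqP->.
  by rewrite xE row_col_neq.
rewrite /weakly_exceeds val_col // ifF; last by lia.
apply: (skip_black (ltnW jn) j2j) => //.
have := s_exc x; rewrite /weakly_exceeds ltnNge xm /= leq_eqVlt => /orP[|]; last by lia.
by rewrite (negPf sx : (s x == x :> nat) = false).
Qed.

End PeelRow.

Lemma pipe_perm_surj p (s : {perm label}) : p <= m ->
    (forall x, weakly_exceeds m x (s x)) -> (forall k, k + p < m -> s k = k) ->
  exists2 w, cauchon_rows w p & pipe_perm w p = s.
Proof.
elim: p s => [|p IH] s pm s_exc s_low.
  exists (fun _ _ => true) => //; apply/esym/perm_le_id => x.
  have [xm|xm] := ltnP x m; first by rewrite s_low ?addn0.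
  by have := s_exc x; rewrite /weakly_exceeds ltnNge xm.
have [w' cw' w'E] := IH (peel p s) (ltnW pm) (peel_exceeds pm s_exc)
  (peel_low pm s_exc s_low).
set r := row_label p in w'E *; pose v := white_from s r.
pose w i := if i == p then v else w' i.
have ww' i j : i < p -> w i j = w' i j by rewrite /w; case: ltngtP.
exists w => [i j|]; last first.
  rewrite /= (eq_pipe_perm (w2 := w')) => [|i j ip _]; last exact: ww'.
  by rewrite /w eqxx w'E mulKVg.
rewrite ltnS leq_eqVlt => /orP[/eqP->|ip] jn; last first.
  rewrite ww' // => /(cw' _ _ ip jn)[black|black]; [left|right] => k kl.
    by rewrite ww' ?black // (ltn_trans kl).
  by rewrite ww' ?black.
rewrite /w eqxx => nvj.
(* Cauchon condition at a black square of the new row: if a white square lies to its left, [s] fixes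
   its column, hence so does [peel], and the column above is black by [pipe_perm_col_fix]. *)
have [/existsP[j0 /andP[j0j vj0]]|none] := boolP [exists j0 : 'I_n, (j0 < j) && v j0].
  have [j1 j10 sj1] := white_fromP (ltn_ord j0) vj0.
  left => i' ip; rewrite -/(w i' j) ww' //.
  move: i' ip; apply/(pipe_perm_col_fix w' (ltnW pm) jn); rewrite w'E.
  rewrite -[in LHS](_ : row_cycle r v n (col_label j) = col_label j).
    by rewrite peelE (black_after jn nvj (leq_ltn_trans j10 j0j)).
  by rewrite row_cycle_col // (negPf nvj).
right=> j' j'j; move/existsPn: none => /(_ (Ordinal (ltn_trans j'j jn))).
by rewrite /= j'j.
Qed.

End PipeDreams.

(** * From traced pipes to the toric permutation *)

Section Toric.
Variables m' n : nat.
Local Notation m := m'.+1.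
Local Notation row_label := (row_label m' n).
Local Notation col_label := (col_label m' n).
Implicit Type D : diagram m n.
Local Open Scope nat_scope.

Definition white D i j := ~~ blk D i j.

Lemma blkE D (i : 'I_m) (j : 'I_n) : blk D i j = D (i, j).
Proof. by rewrite /blk !valK. Qed.

(** The part of the diagram still ahead of a pipe at square (i, j): row [i] up to column [j], then
    all rows above. *)
Definition entering_perm D i j :=
  (row_cycle (row_label i) (white D i) j.+1 * pipe_perm m' n (white D) i)%g.

Lemma traceE D fuel i j : i <= m' -> j < n -> i + j < fuel ->
  trace D fuel true i j = (entering_perm D i j (col_label j)).+1 /\
  trace D fuel false i j = (entering_perm D i j (row_label i)).+1.
Proof.
elim: fuel i j => // fuel IH i j im jn lt_fuel.
set up := if i is i'.+1 then trace D fuel true i' j else (m + j.+1).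
set left := if j is j'.+1 then trace D fuel false i j' else (m - i).
have upE : up = (pipe_perm m' n (white D) i (col_label j)).+1.
  rewrite /up; case: (i) im lt_fuel => [|i'] im lt_fuel.
    by rewrite perm1 val_col // addnS.
  have [-> _] := IH i' j (ltnW im) jn (ltac:(lia)).
  by rewrite pipe_perm_col // permM row_cycle_col.
have leftE : left = (pipe_perm m' n (white D) i (last_white (row_label i) (white D i) j)).+1.
  rewrite /left; case: (j) jn lt_fuel => [|j'] jn lt_fuel.
    by rewrite pipe_perm_row_fix ?leqnn // val_row; lia.
  have [_ ->] := IH i j' im (ltnW jn) (ltac:(lia)).
  by rewrite permM row_cycle_row // ltnW.
rewrite (permM _ _ (col_label j)) (permM _ _ (row_label i)) row_cycle_col // row_cycle_row //= -/up -/left /white.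
by case: (blk D i j).
Qed.

Lemma toric_funE D : 0 < n -> toric_fun D =1 pipe_perm m' n (white D) m.
Proof.
move=> n0 x; apply: val_inj; rewrite val_insubd.
suff -> : toric_nat D x.+1 = (pipe_perm m' n (white D) m x).+1 by rewrite /= ltn_ord.
(* The inverse of omega moves a top label to the bottom of its column and a left label to the right
   end of its row, so both ends of a line carry the same label. *)
rewrite /toric_nat /sigma_nat /omega_inv_nat; case: ltnP => xm.
  have [jn xE] := col_labelK (xm : m <= x).
  rewrite ifT; last by lia.
  have -> : (x.+1 - m).-1 = x - m by lia.
  have [-> _] := @traceE D (m + n) m' (x - m) (leqnn _) jn (ltac:(lia)).
  by rewrite [in RHS]xE permM row_cycle_col // permM row_cycle_col.
rewrite ifF; last by lia.
have -> : m - (x.+1 + n - n) = m' - x by lia.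
have [_ ->] := @traceE D (m + n) (m' - x) n.-1 (leq_subr _ _) (ltac:(lia)) (ltac:(lia)).
rewrite [in RHS](row_labelK (xm : x < m)) pipe_perm_row; last by lia.
by rewrite permM row_cycle_row prednK.
Qed.

Lemma toric_permE D : 0 < n -> toric_perm D = Some (pipe_perm m' n (white D) m).
Proof.
move=> n0; have tE := toric_funE D n0; rewrite /toric_perm.
case: injectiveP => [inj|[]]; last by move=> x y; rewrite !tE => /perm_inj.
by congr Some; apply/permP => x; rewrite permE.
Qed.

Lemma cauchonP D : reflect (cauchon_rows n (white D) m) (cauchon D).
Proof.
apply: (iffP forallP) => [cD i j im jn|cD [i j]].
  rewrite negbK (blkE D (Ordinal im) (Ordinal jn)) => Dij.
  have := cD (Ordinal im, Ordinal jn); rewrite Dij /=.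
  case/orP=> /forallP black; [left => i' i'i|right => j' j'j].
    have := black (Ordinal (ltn_trans i'i im)); rewrite /= i'i /=.
    by rewrite negbK (blkE D (Ordinal (ltn_trans i'i im)) (Ordinal jn)).
  have := black (Ordinal (ltn_trans j'j jn)); rewrite /= j'j /=.
  by rewrite negbK (blkE D (Ordinal im) (Ordinal (ltn_trans j'j jn))).
apply/implyP => Dij; have := cD i j (ltn_ord i) (ltn_ord j).
rewrite negbK blkE => /(_ Dij) [] black; apply/orP; [left|right];
  apply/forallP => k; apply/implyP => /black; by rewrite negbK blkE.
Qed.

Lemma card_cauchon_toric (P : pred {perm 'I_(m + n)}) : 0 < n ->
  #|[set D : diagram m n | cauchon D && (if toric_perm D is Some s then P s else false)]| =
  #|[set s : {perm 'I_(m + n)} | follows (@weakly_exceeds (m + n) m) s && P s]|.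
Proof.
move=> n0; set X := [set D | _].
rewrite -(@card_in_imset _ _ (fun D : diagram m n => pipe_perm m' n (white D) m) (mem X)).
  apply: eq_card => s; rewrite inE; apply/imsetP/andP => [[D]|[/forallP sF Ps]].
    rewrite inE toric_permE // => /andP[_ PD] ->; split=> //.
    by apply/forallP => x; apply: pipe_perm_exceeds.
  have [|w cw wE] := @pipe_perm_surj m' n m s (leqnn _) sF.
    (* With all [m] rows present the condition on lower rows is empty. *)
    by move=> k; lia.
  pose D : diagram m n := [ffun ij : 'I_m * 'I_n => ~~ w ij.1 ij.2].
  have wD i j : i < m -> j < n -> white D i j = w i j.
    by move=> im jn; rewrite /white (blkE D (Ordinal im) (Ordinal jn)) ffunE negbK.
  have DE : pipe_perm m' n (white D) m = s.
    by rewrite -wE; apply: eq_pipe_perm.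
  exists D => //; rewrite inE toric_permE // DE Ps andbT.
  apply/cauchonP => i j im jn; rewrite wD // => /(cw i j im jn)[] black; [left|right] => k kl.
    by rewrite wD ?black // (ltn_trans kl).
  by rewrite wD ?black // (ltn_trans kl).
move=> D1 D2; rewrite !inE => /andP[/cauchonP c1 _] /andP[/cauchonP c2 _] eqD.
apply/ffunP => -[i j]; rewrite -!blkE.
by apply: negb_inj; apply: (pipe_perm_inj (leqnn m) c1 c2 eqD).
Qed.

End Toric.

(** * The cycle polynomial and its values at negative odd integers *)

Section CyclePoly.
Variables (m n : nat).
Local Notation exc := (@weakly_exceeds (m + n) m).

Definition cycle_poly : {poly rat} :=
  \sum_(s : {perm 'I_(m + n)} | follows exc s) 'X^(num_odd_cycles s).

Lemma coef_cycle_poly d : cycle_poly`_d =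
  #|[set s : {perm 'I_(m + n)} | follows exc s && (num_odd_cycles s == d)]|%:R.
Proof.
rewrite -sum1_card natr_sum coef_sum big_mkcond [RHS]big_mkcond /=.
apply: eq_bigr => s _; rewrite inE coefXn eq_sym.
by case: (follows _ _); case: eqP.
Qed.

Lemma horner_cycle_poly (t : rat) :
  cycle_poly.[t] = cycle_sum exc (fun l => if odd l then 1 else t) setT.
Proof.
rewrite horner_sum; apply: eq_big => [s|s _].
  by have -> : perm_on setT s by apply/subsetP => x _; rewrite inE.
rewrite hornerXn /cycle_weight.
have -> : cycles_in s setT = porbits s by apply/setP => C; rewrite inE subsetT andbT.
rewrite (bigID (fun C : {set _} => odd #|C|)) /= big1 ?mul1r => [|C /andP[_ ->]//].
rewrite (eq_bigr (fun=> t)) => [|C /andP[_ /negPf->]//].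
by rewrite prodr_const; congr (_ ^+ _); apply: eq_card => C; rewrite !inE.
Qed.

Lemma poly_ext_inj (p q : {poly rat}) (f : nat -> rat) : injective f ->
  (forall k, p.[f k] = q.[f k]) -> p = q.
Proof.
move=> f_inj pq; apply/eqP; rewrite -subr_eq0; apply: contraT => pq0.
(* A nonzero [p - q] has fewer roots than its size, but that many distinct points [f k] are
   roots. *)
have := max_poly_roots pq0 (rs := map f (iota 0 (size (p - q)))).
rewrite size_map size_iota ltnn map_inj_uniq // iota_uniq => -> //.
apply/allP => _ /mapP[k _ ->]; rewrite /root !hornerE pq subrr //.
Qed.

Lemma cycle_polyE : cycle_poly = (m`! * n`!)%:R *: Cser m n.
Proof.
apply: (@poly_ext_inj _ _ (fun k => - (k.*2.+1)%:R)) => [k l /eqP|k].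
  by rewrite eqr_opp eqr_nat eqSS => /eqP/double_inj.
rewrite hornerZ horner_Cser horner_cycle_poly (egf_parity_weight m (- (k.*2.+1)%:R)).
have rowsE : rows (m + n) m = [set lshift n i | i in 'I_m].
  apply/setP => x; rewrite inE; apply/idP/imsetP => [xm|[i _ ->]]; last exact: (ltn_ord i).
  by exists (Ordinal xm) => //; apply: val_inj.
have card_rows : #|rows (m + n) m| = m.
  by rewrite rowsE card_imset ?card_ord //; apply: lshift_inj.
by rewrite setTI cardsDS ?subsetT // cardsT card_ord card_rows addKn.
Qed.

End CyclePoly.

(* h(m,n,d) = coefficient of t^d x^m/m! y^n/n! in C(x,y,t) *)
Theorem theorem5p2 (m n d : nat) (hm : (1 <= m)%N) (hn : (1 <= n)%N) :
  (h m n d)%:R = (Cser m n)`_d * (m`! * n`!)%:R :> rat.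
Proof.
case: m hm => // m' _.
rewrite /h (@card_cauchon_toric _ _ (fun s => num_odd_cycles s == d)) // -coef_cycle_poly.
by rewrite cycle_polyE coefZ mulrC.
Qed.
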